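(* Let $p$ be such that for each $t\in(a,b)$ and for all sufficiently small $|h|$, $$p(t,h)<t \ \text{ if } h<0,\qquad p(t,h)>t\ \text{ if } h>0 .$$ Let $f:[a,b]\to\mathbb{R}$ be continuous on $[a,b]$ and such that $D_pf(t)$ exists for every $t\in(a,b)$. Assume in addition that the $p$-derivative of the function $t\mapsto t-a$ exists for all $t\in(a,b)$. Then there is $c\in(a,b)$ such that $$D_pf(c)=\frac{f(b)-f(a)}{b-a}\,k,$$ where $k$ is the $p$-derivative of the function $t\mapsto t-a$ evaluated at $t=c$, i.e. $k=D_p(t-a)\big|_{t=c}$.
   Context: Here $p(t,h)$ is a real-valued function defined for $t\in(a,b)$ and $|h|<\delta$, where $\delta>0$ is generally unspecified (it may depend on $t$), with values in $[a,b]$. The $p$-derivative of a function $g:[a,b]\to\mathbb{R}$ at $t\in(a,b)$ is $$D_pg(t)=\lim_{h\to0}\frac{g(p(t,h))-g(t)}{h},$$ and it is said to exist if this limit exists and is finite. *)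

(* Defs.v *)
From HB Require Import structures.
From mathcomp Require Import all_boot all_order all_algebra.
From mathcomp Require Import all_classical all_reals all_analysis.
Import Order.TTheory GRing.Theory Num.Theory.
Import numFieldNormedType.Exports.

Set Implicit Arguments.
Unset Strict Implicit.
Unset Printing Implicit Defensive.

Local Open Scope classical_set_scope.
Local Open Scope ring_scope.

Section PDerivative.
Variable R : realType.
Implicit Types (p : R -> R -> R) (g : R -> R) (t h : R).

(* p and g are total functions; only their values on the actual domains
   (t in ]a, b[ and h near 0 for p, [a, b] for g) influence the limits below. *)
Definition pquotient p g t h : R := (g (p t h) - g t) / h.

(* Limits are along the punctured neighborhoods of 0, so only h != 0 counts.
   Convergence is in R (not \bar R), hence the limit is finite. *)
Definition pderivable p g t : Prop := cvg (pquotient p g t h @[h --> 0^']).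

(* Meaningful only under [pderivable p g t]. *)
Definition pderive p g t : R := lim (pquotient p g t h @[h --> 0^']).

End PDerivative.

(* Main.v *)
Require Import Defs.
From HB Require Import structures.
From mathcomp Require Import all_boot all_order all_algebra.
From mathcomp Require Import all_classical all_reals all_analysis.
From mathcomp Require Import ring lra.
Import Order.TTheory GRing.Theory Num.Theory.
Import numFieldNormedType.Exports.

(** The proof follows the classical derivation of Lagrange's theorem from
    Rolle's.  With [k] the slope of the chord of [f], the function
    [g s = f s - k * (s - a)] is continuous on the segment and takes equal values
    at both ends, so it has a global extremum at some interior point [c]
    ([rolle_extremum]).  Since [p c h] stays in the segment for small [h], the
    increments [g (p c h) - g c] keep a constant sign, whereas the denominator
    [h] changes sign with [h]; of the one-sided limits at 0 of the difference
    quotient, one is therefore at most 0 and the other at least 0, and their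
    common value is 0
    ([pquotient_max_lim0], [pquotient_min_lim0]).  The [p]-derivative is linear in
    the differentiated function ([cvg_pquotient_sub]), so this vanishing limit
    equals [D_p f c - k * D_p (s - a) c], which is the claim. *)

Set Implicit Arguments.
Unset Strict Implicit.
Unset Printing Implicit Defensive.

Local Open Scope classical_set_scope.
Local Open Scope ring_scope.

Lemma cvg_pquotient_sub (R : realType) (p : R -> R -> R) (f g : R -> R)
    (k t : R) :
  pderivable p f t -> pderivable p g t ->
  pquotient p (fun s => f s - k * g s) t h @[h --> 0^'] -->
    pderive p f t - k * pderive p g t.
Proof.
move=> df dg.
have -> : pquotient p (fun s => f s - k * g s) t =
    (fun h => pquotient p f t h - k * pquotient p g t h).
  by apply/funext => h; rewrite /pquotient; ring.
by apply: cvgB; [exact: df | apply: cvgMl_tmp; exact: dg].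
Qed.

(** The quotient is nonpositive on the right of 0 and nonnegative on its left,
    and both one-sided limits agree. *)
Lemma pquotient_max_lim0 (R : realType) (p : R -> R -> R) (g : R -> R)
    (t l : R) :
  (\forall h \near 0, g (p t h) <= g t) ->
  pquotient p g t h @[h --> 0^'] --> l -> l = 0.
Proof.
move=> gmax gl; apply/eqP; rewrite eq_le; apply/andP; split.
- apply: cvgr_to_le (cvg_dnbhs_at_right gl) _.
  near=> h.
  have h0 : 0 < h by near: h; exact: nbhs_right_gt.
  rewrite /pquotient pmulr_lle0 ?invr_gt0// subr_le0.
  by near: h; exact: cvg_within gmax.
- apply: cvgr_to_ge (cvg_dnbhs_at_left gl) _.
  near=> h.
  have h0 : h < 0 by near: h; exact: nbhs_left_lt.
  rewrite /pquotient nmulr_lge0 ?invr_lt0// subr_le0.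
  by near: h; exact: cvg_within gmax.
Unshelve. all: by end_near. Qed.

Lemma pquotient_min_lim0 (R : realType) (p : R -> R -> R) (g : R -> R)
    (t l : R) :
  (\forall h \near 0, g t <= g (p t h)) ->
  pquotient p g t h @[h --> 0^'] --> l -> l = 0.
Proof.
move=> gmin gl; apply/eqP; rewrite -oppr_eq0; apply/eqP.
apply: (@pquotient_max_lim0 _ p (fun s => - g s) t).
  by apply: filterS gmin => h; rewrite lerN2.
have -> : pquotient p (fun s => - g s) t = (fun h => - pquotient p g t h).
  by apply/funext => h; rewrite /pquotient; ring.
exact: cvgN gl.
Qed.

(** Suppose that a maximizer and a minimizer both fall on ends of the segment:
    the extreme values then coincide because the end values do, so the function is
    constant and any interior point will do. *)
Lemma rolle_extremum (R : realType) (a b : R) (g : R -> R) :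
  a < b -> {within `[a, b], continuous g} -> g a = g b ->
  exists2 c, c \in `]a, b[ &
    (forall t, t \in `[a, b] -> g t <= g c) \/
    (forall t, t \in `[a, b] -> g c <= g t).
Proof.
move=> ab gc gab.
have [M Mab gM] := EVT_max (ltW ab) gc.
have [m mab gm] := EVT_min (ltW ab) gc.
have interior_or_end c : c \in `[a, b] -> (c \in `]a, b[) \/ g c = g a.
  rewrite !in_itv/= => /andP[ac cb].
  have [->|ca] := eqVneq c a; first by right.
  have [->|cb'] := eqVneq c b; first by right.
  by left; rewrite !lt_neqAle ac cb eq_sym ca cb'.
have [Mo|gMa] := interior_or_end _ Mab; first by exists M => //; left.
have [mo|gma] := interior_or_end _ mab; first by exists m => //; right.
have mido : (a + b) / 2 \in `]a, b[.
  by rewrite in_itv/=; apply/andP; split; lra.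
exists ((a + b) / 2) => //; left => t tab.
rewrite (le_trans (gM _ tab))// gMa -gma gm//.
exact: subset_itv_oo_cc mido.
Qed.

Theorem theorem3p4 (R : realType) (a b : R) (ab : a < b)
  (p : R -> R -> R) (delta : R -> R)
  (delta_gt0 : forall t, t \in `]a, b[ -> 0 < delta t)
  (p_itv : forall t h, t \in `]a, b[ -> `|h| < delta t -> p t h \in `[a, b])
  (p_sign : forall t, t \in `]a, b[ ->
     \forall h \near (0 : R), (h < 0 -> p t h < t) /\ (0 < h -> t < p t h))
  (f : R -> R)
  (f_cont : {within `[a, b], continuous f})
  (f_pder : forall t, t \in `]a, b[ -> pderivable p f t)
  (id_pder : forall t, t \in `]a, b[ -> pderivable p (fun s => s - a) t) :
  exists2 c, c \in `]a, b[ &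
    pderive p f c = (f b - f a) / (b - a) * pderive p (fun s => s - a) c.
Proof.
set k := (f b - f a) / (b - a).
pose g s := f s - k * (s - a).
have g_cont : {within `[a, b], continuous g}.
  have lin_cont : {within `[a, b], continuous (fun s => k * (s - a))}.
    apply: continuous_subspaceT => y.
    by apply: cvgMl_tmp; apply: cvgB; [exact: cvg_id | exact: cvg_cst].
  by move=> x; apply: cvgB; [exact: f_cont | exact: lin_cont].
have gab : g a = g b.
  by rewrite /g /k subrr mulr0 divfK ?subr_eq0 ?gt_eqF//; ring.
have [c cab gc] := rolle_extremum ab g_cont gab.
exists c => //; apply/eqP; rewrite -subr_eq0; apply/eqP.
have gl := cvg_pquotient_sub (k := k) (f_pder _ cab) (id_pder _ cab).
have p_near : \forall h \near 0, p c h \in `[a, b].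
  by apply: filterS (nbhs0_lt (delta_gt0 _ cab)) => h; exact: p_itv.
case: gc => gc.
- by apply: pquotient_max_lim0 gl; apply: filterS p_near => h; exact: gc.
- by apply: pquotient_min_lim0 gl; apply: filterS p_near => h; exact: gc.
Qed.
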